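(* Work in the asymptotic setup of the context with $\lambda>0$ fixed. Suppose there exist $t_0>0$ and $\Delta>0$ such that for every $0<t\le t_0$ the set $\{x\in\mathbb R: f_0(x)/f(x)\le t\}$ is a finite union of disjoint intervals with endpoints $a_m(t)<b_m(t)$, $m=1,\dots,M$ (infinite endpoints allowed), where for each $m$ either $a_m(t)>\Delta$ or $b_m(t)<-\Delta$. Fix a threshold $t^*\in(0,t_0]$ and let $\xi=\mathrm{tpp}^*(t^*;\lambda)$ be the asymptotic TPP of the oracle procedure $\hat{\mathcal S}^*(t^* )$. Let $\varphi:\mathbb R\to\mathbb R$ and a fixed threshold $t\in\mathbb R$ be given, consider the procedure selecting $\{i\le p:\varphi(\hat\beta_i(\lambda))>t\}$, and let $\mathrm{fdp}^\varphi(t;\lambda)$ and $\mathrm{tpp}^\varphi(t;\lambda)$ be the limits in probability, as $p\to\infty$, of its FDP and TPP, when they exist. Assume $\varphi$ is such that, for both $\psi(x,y)=\mathbf 1\{\varphi(x)>t\}\mathbf 1\{y=0\}$ and $\psi(x,y)=\mathbf 1\{\varphi(x)>t\}$, $$\frac1p\sum_{i=1}^p\psi(\hat\beta_i,\beta_i)\ \longrightarrow\ \mathbb E[\psi(\eta_{\alpha\tau}(\Pi+\tau Z),\Pi)]\quad\text{almost surely as }p\to\infty.$$ If $\mathrm{tpp}^\varphi(t;\lambda)=\xi$, then $\mathrm{fdp}^*(t^*;\lambda)\le\mathrm{fdp}^\varphi(t;\lambda)$.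
   Context: Setup. For each $p$, $n=n(p)$ with $n/p\to\delta\in(0,\infty)$ as $p\to\infty$. $Y=\boldsymbol X\beta+\zeta$, $\zeta\sim\mathcal N_n(0,\sigma^2\boldsymbol I)$, $\sigma>0$; $\boldsymbol X\in\mathbb R^{n\times p}$ has i.i.d. $\mathcal N(0,1/n)$ entries; $\beta_1,\dots,\beta_p$ are i.i.d. with law $\Pi=(1-\epsilon)\delta_0+\epsilon\Pi_1$, $\epsilon\in(0,1)$, $\mathbb P(\Pi_1=0)=0$, $\mathbb E\Pi^2<\infty$; $\boldsymbol X,\beta,\zeta$ are independent. ($\Pi,\Pi_1$ also denote random variables with these laws.) For $\lambda>0$, $\hat\beta=\hat\beta(\lambda)=\operatorname{argmin}_{b\in\mathbb R^p}\frac12\|Y-\boldsymbol Xb\|_2^2+\lambda\|b\|_1$. $\eta_s(x)=\operatorname{sign}(x)(|x|-s)_+$; $\Phi,\phi$ are the standard normal c.d.f. and density; $Z\sim\mathcal N(0,1)$ is independent of $\Pi,\Pi_1$. $(\alpha,\tau)$ is the unique solution with $\tau>0$, $\alpha>\alpha_{\min}$ of $$\tau^2=\sigma^2+\tfrac1\delta\mathbb E[(\eta_{\alpha\tau}(\Pi+\tau Z)-\Pi)^2],\qquad \lambda=\alpha\tau\big(1-\tfrac1\delta\mathbb P(|\Pi+\tau Z|>\alpha\tau)\big),$$ where $\alpha_{\min}$ is the unique non-negative root of $(\alpha^2+1)\Phi(-\alpha)-\alpha\phi(\alpha)=\delta/2$ (and $\alpha_{\min}=0$ if $\delta\ge1$).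 Densities. For $x\ne0$: $q_0(x)=\frac1\tau\phi\big(\frac{x+\alpha\tau\operatorname{sign}(x)}{\tau}\big)$, $q_1(x)=\mathbb E\big[\frac1\tau\phi\big(\frac{x+\alpha\tau\operatorname{sign}(x)-\Pi_1}{\tau}\big)\big]$, $q=(1-\epsilon)q_0+\epsilon q_1$; these are the densities of the absolutely continuous parts of the laws of $\eta_{\alpha\tau}(\tau Z)$, $\eta_{\alpha\tau}(\Pi_1+\tau Z)$, $\eta_{\alpha\tau}(\Pi+\tau Z)$. $f_0$ and $f$ are the generalized densities (with an atom at $0$) of $\eta_{\alpha\tau}(\tau Z)$ and $\eta_{\alpha\tau}(\Pi+\tau Z)$: $f_0(x)/f(x)=q_0(x)/q(x)$ for $x\neq0$ and $f_0(0)/f(0)=\mathbb P(|\tau Z|\le\alpha\tau)/\mathbb P(|\Pi+\tau Z|\le\alpha\tau)$. Convention: the event $q_0(x)/q(x)\le t$ is regarded as not occurring when $x=0$. For a procedure selecting $\hat{\mathcal S}\subseteq\{1,\dots,p\}$, $\mathrm{FDP}=|\hat{\mathcal S}\cap\{i:\beta_i=0\}|/|\hat{\mathcal S}|$ and $\mathrm{TPP}=|\hat{\mathcal S}\cap\{i:\beta_i\ne0\}|/|\{i:\beta_i\ne0\}|$, with $0/0:=0$. The oracle procedure is $\hat{\mathcal S}^*(t)=\{i\le p:\hat\beta_i\ne0,\ q_0(\hat\beta_i)/q(\hat\beta_i)\le t\}$, and $\mathrm{fdp}^*(t;\lambda)$, $\mathrm{tpp}^*(t;\lambda)$ are the limits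 in probability of its FDP and TPP, given by $$\mathrm{tpp}^*(t;\lambda)=\mathbb P\Big(\tfrac{q_0(\eta_{\alpha\tau}(\Pi_1+\tau Z))}{q(\eta_{\alpha\tau}(\Pi_1+\tau Z))}\le t\Big),\qquad \mathrm{fdp}^*(t;\lambda)=\frac{(1-\epsilon)\,\mathbb P\big(\tfrac{q_0(\eta_{\alpha\tau}(\tau Z))}{q(\eta_{\alpha\tau}(\tau Z))}\le t\big)}{(1-\epsilon)\,\mathbb P\big(\tfrac{q_0(\eta_{\alpha\tau}(\tau Z))}{q(\eta_{\alpha\tau}(\tau Z))}\le t\big)+\epsilon\,\mathrm{tpp}^*(t;\lambda)}.$$ *)

(* Defs.v *)
From HB Require Import structures.
From mathcomp Require Import all_boot all_order all_algebra.
From mathcomp Require Import all_classical all_reals all_analysis.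

Set Implicit Arguments.
Unset Strict Implicit.
Unset Printing Implicit Defensive.

Import Order.TTheory GRing.Theory Num.Theory.
Import numFieldNormedType.Exports.

Local Open Scope classical_set_scope.
Local Open Scope ring_scope.

Section Probability.
Context (d : measure_display) (Omega : measurableType d) (R : realType).
Variable P : probability Omega R.

Definition has_law (V : {RV P >-> R}) (mu : set R -> \bar R) : Prop :=
  forall A : set R, measurable A -> distribution P V A = mu A.

(* For a finite family the product rule over the whole family gives the one
   over every subfamily: take [B i = setT] off the subfamily. *)
Definition mutually_independent (I : finType) (V : I -> {RV P >-> R}) : Prop :=
  forall B : I -> set R, (forall i, measurable (B i)) ->
  P (\bigcap_(i in [set: I]) (V i @^-1` B i)) =
  (\prod_(i : I) P (V i @^-1` B i))%E.

Definition cvg_in_probability (U : nat -> Omega -> R) (l : R) : Prop :=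
  forall e : R, 0 < e ->
  P [set w | e < `|U k w - l|] @[k --> \oo] --> 0%E.

End Probability.

Section LinearModel.
Context (d : measure_display) (Omega : measurableType d) (R : realType).
Variable P : probability Omega R.

(* All the scalar random inputs of one regression problem as a single family. *)
Definition model_inputs (n p : nat) (X : 'I_n -> 'I_p -> {RV P >-> R})
    (beta : 'I_p -> {RV P >-> R}) (zeta : 'I_n -> {RV P >-> R})
    (k : ('I_n * 'I_p) + ('I_p + 'I_n)) : {RV P >-> R} :=
  match k with
  | inl ij => X ij.1 ij.2
  | inr (inl j) => beta j
  | inr (inr i) => zeta i
  end.

(* [normal_prob m s] has mean [m] and standard deviation [s].  Independence of
   the whole family encodes at once: i.i.d. entries of X, i.i.d. beta_j,
   covariance sigma^2 I for zeta, and independence of X, beta and zeta. *)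
Definition gaussian_linear_model (n p : nat) (Pi : probability (measurableTypeR R) R) (sigma : R)
    (X : 'I_n -> 'I_p -> {RV P >-> R})
    (beta : 'I_p -> {RV P >-> R}) (zeta : 'I_n -> {RV P >-> R}) : Prop :=
  [/\ mutually_independent (model_inputs X beta zeta),
      forall i j, has_law (X i j) (normal_prob 0 (Num.sqrt (n%:R^-1))),
      forall j, has_law (beta j) Pi &
      forall i, has_law (zeta i) (normal_prob 0 sigma)].

End LinearModel.

Section Lasso.
Context (R : realType).

Definition lasso_objective (n p : nat) (X : 'M[R]_(n, p)) (Y : 'cV[R]_n)
    (lambda : R) (b : 'cV[R]_p) : R :=
  2^-1 * (\sum_(i < n) ((Y - X *m b) i ord0) ^+ 2)
  + lambda * \sum_(j < p) `|b j ord0|.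

Definition is_lasso (n p : nat) (X : 'M[R]_(n, p)) (Y : 'cV[R]_n)
    (lambda : R) (b : 'cV[R]_p) : Prop :=
  forall b' : 'cV[R]_p,
    lasso_objective X Y lambda b <= lasso_objective X Y lambda b'.

(* [x / 0 = 0] in a field, which is the convention 0/0 := 0. *)
Definition FDP (p : nat) (b : 'I_p -> R) (S : {set 'I_p}) : R :=
  #|(S :&: [set i | b i == 0])%SET|%:R / #|S|%:R.

Definition TPP (p : nat) (b : 'I_p -> R) (S : {set 'I_p}) : R :=
  #|(S :&: [set i | b i != 0])%SET|%:R / #|[set i | b i != 0]%SET|%:R.

End Lasso.

Section Limits.
Context (R : realType).

Definition soft_threshold (s x : R) : R := Num.sg x * Num.max (`|x| - s) 0.

Definition gauss_cdf (x : R) : R := fine (normal_prob (0 : R) 1 `]-oo, x]).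

Definition is_alpha_min (delta a : R) : Prop :=
  if 1 <= delta then a = 0
  else 0 <= a /\
       (a ^+ 2 + 1) * gauss_cdf (- a) - a * normal_pdf 0 1 a = delta / 2.

(* Joint law of (U, Z) with U of law [mu] and Z standard normal, independent. *)
Definition with_noise (mu : probability (measurableTypeR R) R) :
    probability (measurableTypeR R * measurableTypeR R)%type R :=
  (mu \x normal_prob (0 : R) 1)%E.

Definition state_evolution (Pi : probability (measurableTypeR R) R)
    (delta sigma lambda alpha tau : R) : Prop :=
  (tau ^+ 2)%:E = ((sigma ^+ 2)%:E + (delta^-1)%:E *
     'E_(with_noise Pi)[fun u =>
        ((soft_threshold (alpha * tau) (u.1 + tau * u.2) - u.1) ^+ 2)%R])%E
  /\
  lambda = alpha * tau *
    (1 - delta^-1 *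
         fine (with_noise Pi [set u | alpha * tau < `|u.1 + tau * u.2|])).

Section Oracle.
Variables (eps : R) (Pi Pi1 : probability (measurableTypeR R) R) (alpha tau : R).

Definition q0 (x : R) : R :=
  tau^-1 * normal_pdf 0 1 ((x + alpha * tau * Num.sg x) / tau).

Definition q1 (x : R) : R :=
  fine ('E_Pi1[fun u : R =>
    (tau^-1 * normal_pdf 0 1 ((x + alpha * tau * Num.sg x - u) / tau))%R])%E.

Definition q (x : R) : R := (1 - eps) * q0 x + eps * q1 x.

(* f_0 / f; the value at 0 is the ratio of the atoms of the two laws.  The
   numerator is the mass under U = 0, i.e. of tau Z alone. *)
Definition f0_over_f (x : R) : R :=
  if x == 0 then
    fine (normal_prob (0 : R) 1 [set z | `|tau * z| <= alpha * tau]) /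
    fine (with_noise Pi [set u | `|u.1 + tau * u.2| <= alpha * tau])
  else q0 x / q x.

Definition oracle_accepts (t x : R) : bool := (x != 0) && (q0 x / q x <= t).

Definition tpp_star (t : R) : R :=
  fine (with_noise Pi1
    [set u | oracle_accepts t (soft_threshold (alpha * tau) (u.1 + tau * u.2))]).

Definition null_star (t : R) : R :=
  fine (normal_prob (0 : R) 1
    [set z | oracle_accepts t (soft_threshold (alpha * tau) (tau * z))]).

Definition fdp_star (t : R) : R :=
  (1 - eps) * null_star t / ((1 - eps) * null_star t + eps * tpp_star t).

End Oracle.

(* [I] is an interval with endpoints [a], [b], each one included or not. *)
Definition interval_with_endpoints (I : set R) (a b : \bar R) : Prop :=
  [set x : R | (a < x%:E < b)%E] `<=` I /\
  I `<=` [set x : R | (a <= x%:E <= b)%E].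

Definition intervals_away_from_0 (Delta : R) (A : set R) : Prop :=
  exists (M : nat) (I : 'I_M -> set R) (a b : 'I_M -> \bar R),
  [/\ A = \bigcup_(m in [set: 'I_M]) I m,
      trivIset [set: 'I_M] I &
      forall m, [/\ (a m < b m)%E, interval_with_endpoints (I m) (a m) (b m) &
                    (Delta%:E < a m)%E \/ (b m < (- Delta)%:E)%E]].

(* [bhat], [b] : the triangular arrays of estimates and of true coefficients. *)
Definition empirical_mean_cvg (d : measure_display) (Omega : measurableType d)
    (P : probability Omega R) (Pi : probability (measurableTypeR R) R) (alpha tau : R)
    (bhat b : forall p : nat, 'I_p -> {RV P >-> R}) (psi : R -> R -> R) : Prop :=
  {ae P, forall w,
    (p%:R^-1 * \sum_(i < p) psi (bhat p i w) (b p i w))%:E @[p --> \oo] -->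
    'E_(with_noise Pi)[fun u =>
       psi (soft_threshold (alpha * tau) (u.1 + tau * u.2)%R) u.1]%E}.

End Limits.

(* Main.v *)
Require Import Defs.
From HB Require Import structures.
From mathcomp Require Import all_boot all_order all_algebra.
From mathcomp Require Import all_classical all_reals all_analysis.
From mathcomp Require Import measurable_realfun.
From mathcomp Require Import ring lra.

Set Implicit Arguments.
Unset Strict Implicit.
Unset Printing Implicit Defensive.

Import Order.TTheory GRing.Theory Num.Theory.
Import numFieldNormedType.Exports.

Local Open Scope classical_set_scope.
Local Open Scope ring_scope.

(** The argument is the Neyman-Pearson lemma applied to [m0], the law of
    [eta (tau Z)], and [m1], the law of [eta (Pi1 + tau Z)].  Let [A] be the
    selection region [phi > t] and [B] the oracle region.  Away from [0] both
    laws are images under [eta] of measures with densities whose values at [v]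
    are [q0 (eta v)] and [q1 (eta v)], so acceptance means
    [c * q0 <= k * q1] with [c = 1 - t* (1 - eps)] and [k = t* eps].  The
    sublevel sets of [f0 / f] avoid [0], which says both that the atom at [0]
    is on the rejection side and that [c > 0].  Hence [m1 A = m1 B] implies
    [m0 B <= m0 A].

    The identities [TPP = m1 A] and [FDP = (1 - eps) m0 A / (...)] need no law
    of large numbers: [FDP * #S / p] and [TPP * #{beta <> 0} / p] are bounded,
    so their expectations converge, and they can be computed in two ways, from
    the limits in probability of FDP and TPP and from the almost sure limits of
    the empirical means.  The expectation of [#{beta <> 0} / p] is exactly
    [eps]. *)

(** * Gaussian noise and soft thresholding *)

Section AffineNoise.
Context (R : realType).
Notation leb := (@lebesgue_measure R).

Lemma measurable_affine (a b : R) : measurable_fun setT (fun v : R => a + b * v).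
Proof. by apply: measurable_funD => //; exact: mulrl_measurable. Qed.

(** By uniqueness of Lebesgue measure: [s] times its pushforward under [z |-> u + s * z] gives every
    half-open interval its length. *)
Lemma lebesgue_measure_affine (u s : R) (A : set R) : 0 < s -> measurable A ->
  leb ((fun z => u + s * z) @^-1` A) = ((s^-1)%:E * leb A)%E.
Proof.
move=> s0 mA; pose f (z : measurableTypeR R) : measurableTypeR R := u + s * z.
have mf : measurable_fun setT f by exact: measurable_affine.
pose m : {measure set (measurableTypeR R) -> \bar R} := mscale (NngNum (ltW s0))
  (measure_function_pushforward__canonical__measure_function_Measure leb mf).
have E (B : set (measurableTypeR R)) : m B = (s%:E * leb (f @^-1` B))%E by [].
have mE : leb A = m A.
  apply: (@lebesgue_measure_unique R m) => // _ [] [x y] _ <-; rewrite E.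
  have -> : f @^-1` `]x, y] = `](x - u) / s, (y - u) / s]%classic.
    apply/seteqP; split => z; rewrite /= !in_itv /= ltr_pdivrMr// ler_pdivlMr//;
    by rewrite ltrBlDr lerBrDr /f addrC (mulrC s).
  rewrite !lebesgue_measure_itv /= !lte_fin ltr_pM2r ?invr_gt0// ltrD2r.
  case: ifPn => _; last by rewrite mule0.
  rewrite -!EFinB -EFinM; congr EFin.
  by rewrite -mulrBl mulrCA divff ?gt_eqF// mulr1 opprB addrA addrNK.
by rewrite mE E muleA -EFinM mulVf ?gt_eqF// mul1e.
Qed.

(** Change of variables [v = u + s * z]; the integrand is the density of [u + s * Z]. *)
Lemma normal_prob_affine (u s : R) (D : set R) : 0 < s -> measurable D ->
  normal_prob 0 1 ((fun z => u + s * z) @^-1` D) =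
  (\int[leb]_(v in D) (s^-1 * normal_pdf 0 1 ((v - u) / s))%:E)%E.
Proof.
move=> s0 mD; pose f (z : measurableTypeR R) : measurableTypeR R := u + s * z.
have mf : measurable_fun setT f by exact: measurable_affine.
have i0 : 0 <= s^-1 by rewrite invr_ge0 ltW.
pose g (v : R) : \bar R := (normal_pdf 0 1 ((v - u) / s))%:E.
have mg : measurable_fun setT g.
  apply/measurable_EFinP/measurableT_comp; first exact: measurable_normal_pdf.
  by apply: measurable_funM => //; exact: measurable_funB.
have g0 v : (0 <= g v)%E by rewrite lee_fin normal_pdf_ge0.
under eq_integral do rewrite EFinM.
rewrite ge0_integralZl//; [|exact: measurable_funTS mg|by move=> v _; exact: g0].
pose m : {measure set (measurableTypeR R) -> \bar R} := mscale (NngNum (ltW s0))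
  (measure_function_pushforward__canonical__measure_function_Measure leb mf).
have mE A : measurable A -> leb A = m A.
  move=> mA; rewrite /m /= /mscale /= /pushforward lebesgue_measure_affine//.
  by rewrite muleA -EFinM divff ?gt_eqF// mul1e.
rewrite (@eq_measure_integral _ (measurableTypeR R) R D m); last by move=> A mA _; exact: mE.
rewrite ge0_integral_mscale//; [|exact: measurable_funTS mg|by move=> v _; exact: g0].
rewrite muleA -EFinM mulVf ?gt_eqF// mul1e.
rewrite ge0_integral_pushforward//; [|exact: measurable_funTS mg|by move=> v _; exact: g0].
apply: eq_integral => z _; rewrite /g /f /=.
by rewrite addrAC subrr add0r mulrC mulKf ?gt_eqF.
Qed.

End AffineNoise.

Section NoiseDensity.
Context (R : realType).
Notation leb := (@lebesgue_measure R).
Notation TR := (measurableTypeR R).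

(** The density at [v] of [U + s * Z] with [U] of law [nu], a convolution. Keeping it in [\bar R]
    lets Tonelli apply directly; finiteness is proved separately. *)
Definition noise_density (nu : probability TR R) (s v : R) : \bar R :=
  (\int[nu]_u (s^-1 * normal_pdf 0 1 ((v - u) / s))%:E)%E.

Lemma measurable_noise_kernel (s : R) :
  measurable_fun [set: TR * TR]
    (fun z : TR * TR => s^-1 * normal_pdf 0 1 ((z.2 - z.1) / s)).
Proof.
apply: measurable_funM => //; apply: measurableT_comp; first exact: measurable_normal_pdf.
by apply: measurable_funM => //; exact: measurable_funB.
Qed.

Lemma measurable_noise_density nu (s : R) : 0 < s ->
  measurable_fun setT (noise_density nu s).
Proof.
move=> s0; apply: (@measurable_fun_fubini_tonelli_G _ _ TR TR R nu
  (fun z : TR * TR => (s^-1 * normal_pdf 0 1 ((z.2 - z.1) / s))%:E)).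
  by apply/measurable_EFinP; exact: measurable_noise_kernel.
by move=> z; rewrite lee_fin mulr_ge0 ?normal_pdf_ge0// invr_ge0 ltW.
Qed.

Lemma noise_density_ge0 nu (s v : R) : 0 < s -> (0 <= noise_density nu s v)%E.
Proof.
move=> s0; apply: integral_ge0 => u _.
by rewrite lee_fin mulr_ge0 ?normal_pdf_ge0// invr_ge0 ltW.
Qed.

(** The kernel is at most its peak [s^-1 * normal_peak 1], and [nu] has total mass one. *)
Lemma noise_density_fin_num nu (s v : R) : 0 < s -> noise_density nu s v \is a fin_num.
Proof.
move=> s0; rewrite ge0_fin_numE ?noise_density_ge0//.
apply: (@le_lt_trans _ _ (\int[nu]_(u in setT) (s^-1 * normal_peak 1)%:E)%E).
  apply: ge0_le_integral => //.
  - by move=> u _; rewrite lee_fin mulr_ge0 ?normal_pdf_ge0// invr_ge0 ltW.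
  - apply/measurable_EFinP/measurable_funM => //.
    apply: measurableT_comp; first exact: measurable_normal_pdf.
    by apply: measurable_funM => //; exact: measurable_funB.
  - by move=> u _; rewrite lee_fin ler_wpM2l ?normal_pdf_ub ?invr_ge0 ?ltW.
by rewrite integral_cst//= probability_setT mule1 ltry.
Qed.

(** Condition on [U = u], rewrite the inner Gaussian probability by the affine change of variables,
    and exchange the two integrals by Tonelli. *)
Lemma with_noise_affine (nu : probability TR R) (s : R) (D : set R) :
  0 < s -> measurable D ->
  with_noise nu [set u | D (u.1 + s * u.2)] =
  (\int[leb]_(v in D) noise_density nu s v)%E.
Proof.
move=> s0 mD.
(* The indicator of [D] is put inside the kernel, so that both integrals run over the whole line. *)
pose k (z : TR * TR) : \bar R :=
  ((s^-1 * normal_pdf 0 1 ((z.2 - z.1) / s))%:E * (\1_D z.2)%:E)%E.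
have k0 z : (0 <= k z)%E.
  by rewrite mule_ge0// lee_fin ?mulr_ge0 ?normal_pdf_ge0// invr_ge0 ltW.
have mk : measurable_fun setT k.
  apply: emeasurable_funM; first by apply/measurable_EFinP; exact: measurable_noise_kernel.
  by apply/measurable_EFinP; apply: measurableT_comp => //; exact: measurable_indic.
rewrite /with_noise /product_measure1.
transitivity (\int[nu]_u \int[leb]_v k (u, v))%E.
  apply: eq_integral => u _ /=.
  have -> : xsection [set w : TR * TR | D (w.1 + s * w.2)] u = (fun z => u + s * z) @^-1` D.
    by apply/seteqP; split=> z; rewrite /xsection /= inE.
  by rewrite normal_prob_affine// integral_mkcond epatch_indic.
rewrite fubini_tonelli// [RHS]integral_mkcond epatch_indic.
apply: eq_integral => v _; rewrite /k /= ge0_integralZr//.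
- apply/measurable_EFinP/measurable_funM => //.
  apply: measurableT_comp; first exact: measurable_normal_pdf.
  by apply: measurable_funM => //; exact: measurable_funB.
- by move=> u _; rewrite lee_fin mulr_ge0 ?normal_pdf_ge0// invr_ge0 ltW.
Qed.

End NoiseDensity.

Section SoftThreshold.
Context (R : realType).
Implicit Types s x v : R.

(** This form is built from maxima of affine functions, so measurability needs no case split on the
    sign of [x]. For [s >= 0] at most one of the two maxima is nonzero. *)
Lemma soft_threshold_maxB s x : 0 <= s ->
  soft_threshold s x = Num.max (x - s) 0 - Num.max (- x - s) 0.
Proof.
move=> s0; rewrite /soft_threshold; case: (ltrgt0P x) => [x0|x0|->].
- rewrite gtr0_sg// mul1r (@max_r _ _ (- x - s)) ?subr0//.
  by rewrite subr_le0 (le_trans _ s0)// oppr_le0 ltW.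
- rewrite ltr0_sg// mulN1r (@max_r _ _ (x - s)) ?sub0r//.
  by rewrite subr_le0 (le_trans _ s0)// ltW.
- by rewrite sgr0 mul0r oppr0 subrr.
Qed.

Lemma measurable_soft_threshold s : 0 <= s ->
  measurable_fun setT (soft_threshold s).
Proof.
move=> s0.
rewrite (_ : soft_threshold s = fun x => Num.max (x - s) 0 - Num.max (- x - s) 0).
  by apply: measurable_funB; apply: measurable_maxr => //; apply: measurable_funB.
by apply/funext => x; exact: soft_threshold_maxB.
Qed.

Lemma soft_threshold_eq0 s x : 0 <= s -> (soft_threshold s x == 0) = (`|x| <= s).
Proof.
move=> s0; rewrite /soft_threshold mulf_eq0 sgr_eq0.
have [->|x0] /= := eqVneq x 0; first by rewrite normr0 s0.
by rewrite eq_maxr subr_le0.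
Qed.

(** Off its zero set, soft thresholding is inverted by [x |-> x + s * Num.sg x]. The same shift
    occurs in [q0] and [q1], which is why their values at the thresholded point are densities at
    [v]. *)
Lemma soft_thresholdK s v : 0 <= s -> soft_threshold s v != 0 ->
  soft_threshold s v + s * Num.sg (soft_threshold s v) = v.
Proof.
move=> s0; rewrite soft_threshold_eq0// -ltNge => sv.
rewrite /soft_threshold max_l ?subr_ge0 ?ltW// sgrM (gtr0_sg (_ : 0 < `|v| - s)) ?subr_gt0//.
by rewrite sgr_id mulr1 (mulrC s) -mulrDr subrK -numEsg.
Qed.

End SoftThreshold.

(** * The mixture of null and signal laws *)

Section Mixture.
Context (R : realType).
Notation TR := (measurableTypeR R).
Variables (eps : R) (Pi Pi1 : probability TR R).
Hypothesis eps01 : 0 < eps < 1.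
Hypothesis PiE : forall A : set R, measurable A ->
  Pi A = ((1 - eps)%:E * \d_(0%R : R) A + eps%:E * Pi1 A)%E.

(** The mass of [G] is the integral over [Pi] of the Gaussian mass of its sections. Splitting [Pi]
    into scaled Dirac and signal measures, the Dirac part evaluates this at the section over [0]. *)
Lemma with_noise_mixture (G : set (TR * TR)) : measurable G ->
  with_noise Pi G = ((1 - eps)%:E * normal_prob (0 : R) 1 [set z | G (0%R, z)] +
                     eps%:E * with_noise Pi1 G)%E.
Proof.
move=> mG; case/andP: eps01 => e0 e1.
have e0' : 0 <= eps by exact: ltW.
have e1' : 0 <= 1 - eps by rewrite subr_ge0 ltW.
pose h := normal_prob (0 : R) 1 \o xsection G.
have mh : measurable_fun setT h by exact: measurable_fun_xsection.
have h0 x : (0 <= h x)%E by exact: measure_ge0.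
change (\int[Pi]_x h x = (1 - eps)%:E * normal_prob (0 : R) 1 [set z | G (0%R, z)] +
                          eps%:E * \int[Pi1]_x h x)%E.
rewrite (@eq_measure_integral _ TR R setT
  (measure_add (mscale (NngNum e1') (\d_(0%R : TR))) (mscale (NngNum e0') Pi1))); last first.
  move=> A mA _; apply: (etrans (PiE mA)); apply: esym.
  exact: (measure_addE (mscale (NngNum e1') (\d_(0%R : TR))) (mscale (NngNum e0') Pi1) A).
rewrite ge0_integral_measure_add// !ge0_integral_mscale//.
rewrite integral_dirac// diracT mul1e; congr (_ * _ + _)%E.
by congr normal_prob; apply/seteqP; split=> z; rewrite /xsection /= inE.
Qed.

End Mixture.

(** * The Neyman-Pearson lemma *)

Section NeymanPearson.
Context d0 d1 (T0 : measurableType d0) (T1 : measurableType d1) (R : realType).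
Variables (P0 : probability T0 R) (P1 : probability T1 R).
Variables (f0 : T0 -> R) (f1 : T1 -> R).
Hypothesis mf0 : measurable_fun setT f0.
Hypothesis mf1 : measurable_fun setT f1.

(** The likelihood comparison is stated on masses of sets, not on densities, so that the laws may
    have atoms. Equal power gives [A \ B] and [B \ A] the same mass under [P1]; passing through that
    mass compares their masses under [P0], and the common part [A & B] is then added back. *)
Lemma neyman_pearson (c k : R) (A B : set R) : 0 < c ->
  measurable A -> measurable B ->
  (forall C, measurable C -> C `<=` B ->
    (c%:E * P0 (f0 @^-1` C) <= k%:E * P1 (f1 @^-1` C))%E) ->
  (forall C, measurable C -> C `<=` ~` B ->
    (k%:E * P1 (f1 @^-1` C) <= c%:E * P0 (f0 @^-1` C))%E) ->
  P1 (f1 @^-1` A) = P1 (f1 @^-1` B) ->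
  (P0 (f0 @^-1` B) <= P0 (f0 @^-1` A))%E.
Proof.
move=> c0 mA mB leB geB eqAB.
have m0 C : measurable C -> measurable (f0 @^-1` C).
  by move=> mC; rewrite -[X in measurable X]setTI; exact: mf0.
have m1 C : measurable C -> measurable (f1 @^-1` C).
  by move=> mC; rewrite -[X in measurable X]setTI; exact: mf1.
have mAB : measurable (A `\` B) by exact: measurableD.
have mBA : measurable (B `\` A) by exact: measurableD.
have e1 : P1 (f1 @^-1` (A `\` B)) = P1 (f1 @^-1` (B `\` A)).
  move: eqAB; rewrite (measureDI P1 (m1 _ mA) (m1 _ mB)) (measureDI P1 (m1 _ mB) (m1 _ mA)).
  rewrite (setIC (f1 @^-1` B)).
  move=> /(congr1 (fun x => x - P1 (f1 @^-1` A `&` f1 @^-1` B))%E).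
  by rewrite !addeK// fin_num_measure//; apply: measurableI; exact: m1.
rewrite (measureDI P0 (m0 _ mA) (m0 _ mB)) (measureDI P0 (m0 _ mB) (m0 _ mA)).
rewrite (setIC (f0 @^-1` B)) leeD2r//.
rewrite -(@lee_pmul2l _ c%:E)//.
apply: le_trans (leB _ mBA _) _; first by move=> x [].
by rewrite -e1; apply: geB => // x [].
Qed.

End NeymanPearson.

(** * Optimality of the oracle region *)

Lemma scale_integral_EFin d (T : measurableType d) (R : realType)
    (mu : {measure set T -> \bar R}) (D : set T) (f : T -> R) (c : R) :
  measurable D -> measurable_fun D f -> (forall x, 0 <= f x) -> 0 <= c ->
  (c%:E * \int[mu]_(x in D) (f x)%:E = \int[mu]_(x in D) (c * f x)%:E)%E.
Proof.
move=> mD mf f0 c0; under [RHS]eq_integral do rewrite EFinM.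
apply: esym; apply: ge0_integralZl => //; first exact/measurable_EFinP.
by move=> x _; rewrite lee_fin.
Qed.

Section OracleOptimality.
Context (R : realType).
Notation leb := (@lebesgue_measure R).
Notation TR := (measurableTypeR R).
Variables (eps : R) (Pi Pi1 : probability TR R) (alpha tau : R).
Hypothesis eps01 : 0 < eps < 1.
Hypothesis PiE : forall A : set R, measurable A ->
  Pi A = ((1 - eps)%:E * \d_(0%R : R) A + eps%:E * Pi1 A)%E.
Hypothesis tau_gt0 : 0 < tau.
Hypothesis alpha_ge0 : 0 <= alpha.

Local Notation S := (soft_threshold (alpha * tau)).
Local Notation S0 := (fun z : TR => S (tau * z)).
Local Notation S1 := (fun u : TR * TR => S (u.1 + tau * u.2)).

Let s_ge0 : 0 <= alpha * tau. Proof. by rewrite mulr_ge0// ltW. Qed.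

Let mS : measurable_fun setT S.
Proof. exact: measurable_soft_threshold. Qed.

Let mSpre (C : set R) : measurable C -> measurable (S @^-1` C).
Proof. by move=> mC; rewrite -[X in measurable X]setTI; exact: mS. Qed.

Lemma measurable_null_estimate : measurable_fun setT S0.
Proof.
by apply: (measurableT_comp mS); exact: mulrl_measurable.
Qed.

Lemma measurable_noisy_estimate : measurable_fun setT S1.
Proof.
apply: (measurableT_comp mS); apply: measurable_funD => //.
exact: measurable_funM.
Qed.

(** Since [C] avoids [0], every [v] in its preimage has [S v != 0], where [soft_thresholdK] recovers
    [v] and turns [q0 (S v)] into a Gaussian density at [v]. The atom at [0] is treated on its own
    below. *)
Lemma null_estimate_density (C : set R) : measurable C -> ~ C 0 ->
  normal_prob 0 1 (S0 @^-1` C) =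
  (\int[leb]_(v in S @^-1` C) (q0 alpha tau (S v))%:E)%E.
Proof.
move=> mC C0.
have -> : S0 @^-1` C = (fun z => 0 + tau * z) @^-1` (S @^-1` C).
  by apply/seteqP; split => z; rewrite /= add0r.
rewrite normal_prob_affine//; last exact: mSpre.
apply: eq_integral => v; rewrite inE /= => Cv.
have Sv0 : S v != 0 by apply/eqP => Sv0; rewrite Sv0 in Cv.
by rewrite /q0 [alpha * tau * _ as X in (_ + X) / _]/= soft_thresholdK// subr0.
Qed.

Lemma noisy_estimate_density (C : set R) : measurable C -> ~ C 0 ->
  with_noise Pi1 (S1 @^-1` C) =
  (\int[leb]_(v in S @^-1` C) (q1 Pi1 alpha tau (S v))%:E)%E.
Proof.
move=> mC C0; rewrite (with_noise_affine Pi1 tau_gt0 (mSpre mC)).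
apply: eq_integral => v; rewrite inE /= => Cv.
have Sv0 : S v != 0 by apply/eqP => Sv0; rewrite Sv0 in Cv.
rewrite /q1 unlock soft_thresholdK// -[RHS]/((fine (noise_density Pi1 tau v))%:E).
by rewrite fineK// noise_density_fin_num.
Qed.

Lemma q0_gt0 x : 0 < q0 alpha tau x.
Proof.
rewrite /q0 mulr_gt0 ?invr_gt0// normal_pdfE ?oner_eq0//.
by rewrite mulr_gt0 ?expR_gt0 ?normal_peak_gt0 ?oner_eq0.
Qed.

Lemma q1_ge0 x : 0 <= q1 Pi1 alpha tau x.
Proof. by rewrite /q1 unlock fine_ge0//; exact: noise_density_ge0. Qed.

(** The mixture [q] is positive because [q0] is, so the denominator can be cleared; the [q0] terms
    are then collected on one side. *)
Lemma oracle_acceptsE (t x : R) : x != 0 ->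
  oracle_accepts eps Pi1 alpha tau t x =
  ((1 - t * (1 - eps)) * q0 alpha tau x <= t * eps * q1 Pi1 alpha tau x).
Proof.
move=> x0; case/andP: eps01 => e0 e1; rewrite /oracle_accepts x0 /=.
have q_gt0 : 0 < q eps Pi1 alpha tau x.
  by rewrite ltr_wpDr ?mulr_ge0 ?q1_ge0 ?(ltW e0)// mulr_gt0 ?q0_gt0// subr_gt0.
rewrite ler_pdivrMr// -subr_ge0 -[RHS]subr_ge0 /q.
by congr (0 <= _); ring.
Qed.

Let mS0 (C : set R) : measurable C -> measurable (S0 @^-1` C).
Proof.
by move=> mC; rewrite -[X in measurable X]setTI; exact: measurable_null_estimate.
Qed.

Let mS1 (C : set R) : measurable C -> measurable (S1 @^-1` C).
Proof.
by move=> mC; rewrite -[X in measurable X]setTI; exact: measurable_noisy_estimate.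
Qed.

Let q0_ge0 x : 0 <= q0 alpha tau x. Proof. exact/ltW/q0_gt0. Qed.

Lemma noisy_estimate_mixture (C : set R) : measurable C ->
  with_noise Pi (S1 @^-1` C) =
  ((1 - eps)%:E * normal_prob (0 : R) 1 (S0 @^-1` C) + eps%:E * with_noise Pi1 (S1 @^-1` C))%E.
Proof.
move=> mC; rewrite (with_noise_mixture eps01 PiE (mS1 mC)).
by congr (_ * normal_prob _ _ _ + _)%E; apply/seteqP; split => z /=; rewrite add0r.
Qed.

Lemma measurable_null_density (C : set R) : measurable C -> ~ C 0 ->
  measurable_fun (S @^-1` C) (fun v => q0 alpha tau (S v)).
Proof.
move=> mC C0.
have E : {in S @^-1` C, (fun v : R => tau^-1 * normal_pdf 0 1 (v / tau)) =1
    (fun v => q0 alpha tau (S v))}.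
  move=> v; rewrite inE /= => Cv; rewrite /q0 soft_thresholdK//.
  by apply/eqP => Sv0; rewrite Sv0 in Cv.
apply: (eq_measurable_fun _ E); apply: measurable_funTS; apply: measurable_funM => //.
by apply: measurableT_comp; [exact: measurable_normal_pdf|exact: measurable_funM].
Qed.

Lemma measurable_noisy_density (C : set R) : measurable C -> ~ C 0 ->
  measurable_fun (S @^-1` C) (fun v => q1 Pi1 alpha tau (S v)).
Proof.
move=> mC C0.
have E : {in S @^-1` C, (fun v : R => fine (noise_density Pi1 tau v)) =1
    (fun v => q1 Pi1 alpha tau (S v))}.
  move=> v; rewrite inE /= => Cv; rewrite /q1 unlock soft_thresholdK//.
  by apply/eqP => Sv0; rewrite Sv0 in Cv.
apply: (eq_measurable_fun _ E); apply: measurable_funTS; apply: measurableT_comp => //.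
exact: measurable_noise_density.
Qed.

(** With [a] and [b] the null and signal atoms at [0], the hypothesis reads
    [t < a / ((1 - eps) * a + eps * b)]. Clearing the denominator gives
    [t * eps * b < (1 - t * (1 - eps)) * a], from which both claims follow. *)
Lemma zero_atom_gt (t : R) : 0 <= t -> t < f0_over_f eps Pi Pi1 alpha tau 0 ->
  0 < 1 - t * (1 - eps) /\
  ((t * eps)%:E * with_noise Pi1 (S1 @^-1` [set 0%R]) <=
   (1 - t * (1 - eps))%:E * normal_prob (0 : R) 1 (S0 @^-1` [set 0%R]))%E.
Proof.
move=> t0; case/andP: eps01 => e0 e1; rewrite /f0_over_f eqxx.
have -> : [set z | `|tau * z| <= alpha * tau] = S0 @^-1` [set 0].
  by apply/seteqP; split => z /=; rewrite -soft_threshold_eq0//; [move/eqP|move=> ->].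
have -> : [set u : TR * TR | `|u.1 + tau * u.2| <= alpha * tau] = S1 @^-1` [set 0].
  by apply/seteqP; split => z /=; rewrite -soft_threshold_eq0//; [move/eqP|move=> ->].
rewrite noisy_estimate_mixture//.
have m0 : measurable (S0 @^-1` [set 0]) by exact: mS0.
have m1 : measurable (S1 @^-1` [set 0]) by exact: mS1.
have /fineK <- : normal_prob (0 : R) 1 (S0 @^-1` [set 0]) \is a fin_num.
  exact: fin_num_measure.
have /fineK <- : with_noise Pi1 (S1 @^-1` [set 0]) \is a fin_num.
  exact: fin_num_measure.
set a := fine (normal_prob _ _ _); set b := fine (with_noise _ _).
have a0 : 0 <= a by apply: fine_ge0; exact: measure_ge0.
have b0 : 0 <= b by apply: fine_ge0; exact: measure_ge0.
rewrite -!EFinM -EFinD /= lee_fin => tab.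
have den0 : 0 <= (1 - eps) * a + eps * b.
  by rewrite addr_ge0// mulr_ge0// ?subr_ge0 ltW.
(* A zero denominator would make the quotient [0], contradicting [0 <= t]. *)
have den_gt0 : 0 < (1 - eps) * a + eps * b.
  rewrite lt_neqAle den0 andbT eq_sym; apply/eqP => den.
  by move: tab; rewrite den invr0 mulr0 ltNge t0.
move: tab; rewrite ltr_pdivlMr// => tab.
have teb : 0 <= t * eps * b by rewrite !mulr_ge0// ltW.
have tab' : t * eps * b < (1 - t * (1 - eps)) * a.
  by rewrite -subr_gt0; move: tab; rewrite -subr_gt0; congr (0 < _); ring.
split; last exact: ltW.
(* For [a = 0] the inequality would read [t * eps * b < 0]. Once [a] is positive, it forces its
   coefficient to be positive. *)
have a_gt0 : 0 < a.
  rewrite lt_neqAle a0 andbT eq_sym; apply/eqP => a00.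
  by move: tab'; rewrite a00 mulr0 ltNge teb.
by move: (le_lt_trans teb tab'); rewrite pmulr_lgt0.
Qed.

Lemma scaled_null_mass (C : set R) (c : R) : measurable C -> ~ C 0 -> 0 <= c ->
  (c%:E * normal_prob (0 : R) 1 (S0 @^-1` C) =
   \int[leb]_(v in S @^-1` C) (c * q0 alpha tau (S v))%:E)%E.
Proof.
move=> mC C0 c0; rewrite (null_estimate_density mC C0).
apply: (@scale_integral_EFin _ TR R leb _ _ _ (mSpre mC)
  (measurable_null_density mC C0)).
- by move=> v; exact: q0_ge0.
- exact: c0.
Qed.

Lemma scaled_noisy_mass (C : set R) (k : R) : measurable C -> ~ C 0 -> 0 <= k ->
  (k%:E * with_noise Pi1 (S1 @^-1` C) =
   \int[leb]_(v in S @^-1` C) (k * q1 Pi1 alpha tau (S v))%:E)%E.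
Proof.
move=> mC C0 k0; rewrite (noisy_estimate_density mC C0).
apply: (@scale_integral_EFin _ TR R leb _ _ _ (mSpre mC)
  (measurable_noisy_density mC C0)) => // v.
exact: q1_ge0.
Qed.

(** Both masses are integrals over the same preimage, so the pointwise comparison integrates. *)
Lemma null_mass_le (C : set R) (c k : R) :
  measurable C -> ~ C 0 -> 0 <= c -> 0 <= k ->
  (forall x, C x -> c * q0 alpha tau x <= k * q1 Pi1 alpha tau x) ->
  (c%:E * normal_prob (0 : R) 1 (S0 @^-1` C) <= k%:E * with_noise Pi1 (S1 @^-1` C))%E.
Proof.
move=> mC C0 c0 k0 le_q; rewrite scaled_null_mass// scaled_noisy_mass//.
apply: ge0_le_integral => [|v _|||v /le_q]; last by rewrite lee_fin.
- exact: mSpre.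
- by rewrite lee_fin mulr_ge0.
- apply/measurable_EFinP; apply: measurable_funM => //.
  exact: measurable_null_density.
- apply/measurable_EFinP; apply: measurable_funM => //.
  exact: measurable_noisy_density.
Qed.

Lemma noisy_mass_le (C : set R) (c k : R) :
  measurable C -> ~ C 0 -> 0 <= c -> 0 <= k ->
  (forall x, C x -> k * q1 Pi1 alpha tau x <= c * q0 alpha tau x) ->
  (k%:E * with_noise Pi1 (S1 @^-1` C) <= c%:E * normal_prob (0 : R) 1 (S0 @^-1` C))%E.
Proof.
move=> mC C0 c0 k0 le_q; rewrite scaled_null_mass// scaled_noisy_mass//.
apply: ge0_le_integral => [|v _|||v /le_q]; last by rewrite lee_fin.
- exact: mSpre.
- by rewrite lee_fin mulr_ge0 ?q1_ge0.
- apply/measurable_EFinP; apply: measurable_funM => //.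
  exact: measurable_noisy_density.
- apply/measurable_EFinP; apply: measurable_funM => //.
  exact: measurable_null_density.
Qed.

(** Inside the oracle region only densities matter, because [oracle_accepts] rejects [0]. Outside
    it, the atom at [0] must also be compared, and [zero_atom_gt] does this. *)
Lemma oracle_null_minimal (t : R) (A : set R) : 0 <= t ->
  t < f0_over_f eps Pi Pi1 alpha tau 0 ->
  measurable [set x | oracle_accepts eps Pi1 alpha tau t x] ->
  measurable A ->
  with_noise Pi1 (S1 @^-1` A) =
  with_noise Pi1 (S1 @^-1` [set x | oracle_accepts eps Pi1 alpha tau t x]) ->
  (normal_prob (0 : R) 1 (S0 @^-1` [set x | oracle_accepts eps Pi1 alpha tau t x]) <=
   normal_prob (0 : R) 1 (S0 @^-1` A))%E.
Proof.
move=> t0 tf0 mB mA.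
have k0 : 0 <= t * eps by case/andP: eps01 => /ltW e0 _; exact: mulr_ge0.
have N0_ge0 D : (0 <= normal_prob (0 : R) 1 D)%E by exact: measure_ge0.
have N1_ge0 D : (0 <= with_noise Pi1 D)%E by exact: measure_ge0.
have mf0 : measurable_fun setT S0 by exact: measurable_null_estimate.
have mf1 : measurable_fun setT S1 by exact: measurable_noisy_estimate.
have [c_gt0 atom] := zero_atom_gt t0 tf0; have c0 := ltW c_gt0.
apply: (@neyman_pearson _ _ _ _ R (normal_prob (0 : R) 1) (with_noise Pi1) S0 S1
  mf0 mf1 _ (t * eps) A _ c_gt0 mA mB) => {tf0 c_gt0}.
- move=> C mC CB; have C0 : ~ C 0 by move/CB; rewrite /= /oracle_accepts eqxx.
  apply: (null_mass_le mC C0 c0 k0) => x Cx.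
  have x0 : x != 0 by apply: contra_not_neq C0 => <-.
  by rewrite -(oracle_acceptsE _ x0); exact: CB.
- move=> C mC CB.
  have m0 : measurable [set 0 : R] by [].
  have mC' : measurable (C `\` [set 0]) by exact: measurableD.
  have nC0 : ~ (C `\` [set 0]) 0 by case=> _ /(_ erefl).
  (* Each mass is split into the part off [0], compared through densities, and the part at [0]. *)
  rewrite (measureDI (with_noise Pi1) (mS1 mC) (mS1 m0)).
  rewrite (measureDI (normal_prob (0 : R) 1) (mS0 mC) (mS0 m0)).
  rewrite (ge0_muleDr _ (N1_ge0 _) (N1_ge0 _)) (ge0_muleDr _ (N0_ge0 _) (N0_ge0 _)).
  apply: leeD.
    apply: (noisy_mass_le mC' nC0 c0 k0) => x [Cx /eqP x0].
    have := CB _ Cx; rewrite /= (oracle_acceptsE _ x0).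
    by move/negP; rewrite -ltNge; exact: ltW.
  (* Either [C] contains the whole atom, or its trace on [0] is empty and the signal side
     vanishes. *)
  have [C0|C0] := pselect (C 0).
    rewrite !(setIidr (_ : _ @^-1` [set 0] `<=` _ @^-1` C)); first exact: atom.
    - by move=> z /= ->.
    - by move=> z /= ->.
  have -> : S1 @^-1` C `&` S1 @^-1` [set 0] = set0.
    by apply/seteqP; split=> // u /= [+ Su0]; rewrite Su0.
  rewrite measure0 mule0; apply: mule_ge0; last exact: N0_ge0.
  by rewrite lee_fin.
Qed.

End OracleOptimality.

(** * Limits of FDP and TPP *)

Section BoundedConvergence.
Context d (Omega : measurableType d) (R : realType) (P : probability Omega R).

Lemma integrable_bounded (f : Omega -> R) (M : R) :
  measurable_fun setT f -> (forall w, `|f w| <= M) ->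
  P.-integrable setT (EFin \o f).
Proof.
move=> mf fM; apply: (@le_integrable _ _ _ P _ measurableT _ (EFin \o cst M)).
- exact/measurable_EFinP.
- by move=> w _ /=; rewrite lee_fin (le_trans (fM w))// ler_norm.
- exact: finite_measure_integrable_cst.
Qed.

Lemma bounded_ae_cvg_mean (X : nat -> Omega -> R) (l : R) :
  (forall k, measurable_fun setT (X k)) -> (forall k w, `|X k w| <= 1) ->
  {ae P, forall w, (X k w)%:E @[k --> \oo] --> l%:E} ->
  Rintegral P setT (X k) @[k --> \oo] --> l.
Proof.
move=> mX X1 Xl.
have [_ _] := @dominated_convergence _ _ _ P setT measurableT
  (fun k w => (X k w)%:E) (cst l%:E) (cst 1%E)
  (fun k => iffRL (measurable_EFinP _ _) (mX k)) (measurable_cst _)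
  (filterS (fun w h _ => h) Xl) (finite_measure_integrable_cst P 1 measurableT)
  (aeW P (fun w k _ => X1 k w)).
rewrite integral_cst//= probability_setT mule1.
by move/fine_cvgP => [].
Qed.

(** The integrand [|U - l| * W] is at most [e] off the event [|U - l| > e] and at most [1 + |l|] on
    it, an event of vanishing probability. Hence [|u - l * w| <= e] for every [e > 0]. *)
Lemma cvg_in_probability_mean (U W : nat -> Omega -> R) (l u w : R) :
  (forall k, measurable_fun setT (U k)) -> (forall k, measurable_fun setT (W k)) ->
  (forall k x, 0 <= U k x <= 1) -> (forall k x, 0 <= W k x <= 1) ->
  cvg_in_probability P U l ->
  Rintegral P setT (fun x => U k x * W k x) @[k --> \oo] --> u ->
  Rintegral P setT (W k) @[k --> \oo] --> w ->
  u = l * w.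
Proof.
move=> mU mW U01 W01 Ul UWu Ww.
have nW k x : `|W k x| <= 1 by have /andP[? ?] := W01 k x; rewrite ger0_norm.
have nU k x : `|U k x| <= 1 by have /andP[? ?] := U01 k x; rewrite ger0_norm.
have nUl k x : `|U k x - l| <= 1 + `|l| by rewrite (le_trans (ler_normB _ _))// lerD2r.
have mUl k : measurable_fun setT (fun x => U k x - l) by exact: measurable_funB.
have mUW k : measurable_fun setT (fun x => U k x * W k x) by exact: measurable_funM.
have iW k : P.-integrable setT (EFin \o W k) by exact: (@integrable_bounded _ 1).
have iUW k : P.-integrable setT (EFin \o (fun x => U k x * W k x)).
  by apply: (@integrable_bounded _ 1) => // x; rewrite normrM mulr_ile1.
have ilW k : P.-integrable setT (EFin \o (fun x => l * W k x)).
  apply: (@integrable_bounded _ `|l|); first exact: measurable_funM.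
  by move=> x; rewrite normrM ler_piMr.
apply/eqP; rewrite -subr_eq0 -normr_le0; apply/ler_addgt0Pl => e e0; rewrite addr0.
pose A k := [set x | e < `|U k x - l|].
have mA k : measurable (A k).
  rewrite -[A k]setTI; apply: (measurable_fun_ltr (f := cst e)) => //.
  exact: measurableT_comp.
have PA : fine (P (A k)) @[k --> \oo] --> (0 : R) by have /fine_cvgP[] := Ul e e0.
have lhs : `|Rintegral P setT (fun x => U k x * W k x) - l * Rintegral P setT (W k)|
    @[k --> \oo] --> `|u - l * w|.
  by apply: cvg_norm; apply: cvgB => //; exact: cvgMr.
have rhs : e + (1 + `|l|) * fine (P (A k)) @[k --> \oo] --> e.
  have : e + (1 + `|l|) * fine (P (A k)) @[k --> \oo] --> e + (1 + `|l|) * 0.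
    by apply: cvgD; [exact: cvg_cst|exact: cvgMr].
  by rewrite mulr0 addr0.
apply: (ler_cvg_to lhs rhs); apply: nearW => k.
rewrite -RintegralZl// -RintegralB//.
have iD : P.-integrable setT (EFin \o (fun x => U k x * W k x - l * W k x)).
  apply: (@integrable_bounded _ (1 + `|l|)).
    by apply: measurable_funB => //; exact: measurable_funM.
  by move=> x; rewrite -mulrBl normrM (le_trans _ (nUl k x))// ler_piMr.
apply: (le_trans (le_normr_Rintegral measurableT iD)).
have iA : P.-integrable setT (EFin \o (fun x => (1 + `|l|) * \1_(A k) x)).
  apply: (@integrable_bounded _ (1 + `|l|)).
    by apply: measurable_funM => //; exact: measurable_indic.
  move=> x; rewrite normrM (@ger0_norm _ (1 + `|l|)) ?addr_ge0//.
  by rewrite ler_piMr ?addr_ge0// indicE; case: (_ \in _); rewrite ?normr1 ?normr0.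
have ie : P.-integrable setT (EFin \o cst e) by exact: finite_measure_integrable_cst.
have i1 : P.-integrable setT (EFin \o \1_(A k)).
  apply: (@integrable_bounded _ 1); first exact: measurable_indic.
  by move=> x; rewrite indicE; case: (_ \in _); rewrite ?normr1 ?normr0.
(* The bound is rewritten as a single expectation, so that a pointwise comparison suffices. *)
have -> : e + (1 + `|l|) * fine (P (A k)) =
    Rintegral P setT (fun x => cst e x + (1 + `|l|) * \1_(A k) x).
  rewrite RintegralD// Rintegral_cst//= probability_setT mulr1 RintegralZl//.
  by rewrite /Rintegral integral_indic// setIT.
apply: le_Rintegral => //.
- apply: (@integrable_bounded _ (1 + `|l|)).
    by apply: measurableT_comp => //; apply: measurable_funB => //; exact: measurable_funM.
  by move=> x; rewrite normr_id -mulrBl normrM (le_trans _ (nUl k x))// ler_piMr.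
- exact: (integrableD measurableT ie iA).
- move=> x _; rewrite -mulrBl normrM indicE /=.
  have [xA|xA] := boolP (x \in A k).
    rewrite mulr1 -[leLHS]add0r lerD ?(ltW e0)//.
    by rewrite -[leRHS]mulr1 ler_pM.
  rewrite mulr0 addr0 -[leRHS]mulr1 ler_pM// leNgt.
  by apply: contra xA => ?; rewrite inE.
Qed.

End BoundedConvergence.

(** * Random selection sets and their frequencies *)

Section RandomSets.
Context d (Omega : measurableType d) (R : realType) (P : probability Omega R).

Lemma natr_card_sum (p : nat) (S : {set 'I_p}) :
  #|S|%:R = \sum_(i < p) (i \in S)%:R :> R.
Proof. by rewrite -sum1_card natr_sum big_mkcond /=; apply: eq_bigr => i _; case: ifP. Qed.

(** Imposed coordinate by coordinate, which suffices for cardinalities and spares a sigma-algebra on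
    [{set 'I_p}]. *)
Definition measurable_random_set (p : nat) (S : Omega -> {set 'I_p}) :=
  forall i, measurable [set w | i \in S w].

Lemma measurable_random_setI (p : nat) (S T : Omega -> {set 'I_p}) :
  measurable_random_set S -> measurable_random_set T ->
  measurable_random_set (fun w => S w :&: T w)%SET.
Proof.
move=> mS mT i; rewrite (_ : [set _ | _] = [set w | i \in S w] `&` [set w | i \in T w]).
  exact: measurableI.
by apply/seteqP; split => w /=; rewrite finset.in_setI => /andP.
Qed.

Lemma measurable_random_mem (p : nat) (S : Omega -> {set 'I_p}) i :
  measurable_random_set S -> measurable_fun setT (fun w => (i \in S w)%:R : R).
Proof.
move=> mS; rewrite (_ : (fun w => _) = \1_[set w | i \in S w]); first exact: measurable_indic.
apply/funext => w; rewrite indicE; congr (nat_of_bool _)%:R.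
by apply/idP/idP => [iS|]; rewrite ?inE//; exact: mem_set.
Qed.

Lemma measurable_card (p : nat) (S : Omega -> {set 'I_p}) :
  measurable_random_set S -> measurable_fun setT (fun w => #|S w|%:R : R).
Proof.
move=> mS; rewrite (_ : (fun w => _) = fun w => \sum_(i < p) (i \in S w)%:R).
  by apply: measurable_sum => i; exact: measurable_random_mem.
by apply/funext => w; exact: natr_card_sum.
Qed.

Definition frequency (p : nat) (S : Omega -> {set 'I_p}) (w : Omega) : R :=
  p%:R^-1 * #|S w|%:R.

Lemma measurable_frequency (p : nat) (S : Omega -> {set 'I_p}) :
  measurable_random_set S -> measurable_fun setT (frequency S).
Proof. by move=> mS; apply: measurable_funM => //; exact: measurable_card. Qed.

Lemma frequency_itv (p : nat) (S : Omega -> {set 'I_p}) w :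
  0 <= frequency S w <= 1.
Proof.
rewrite /frequency mulr_ge0 ?invr_ge0//=.
have := max_card (mem (S w)); rewrite card_ord; case: p S => [|p] S Sp.
  (* At [p = 0] the convention [0^-1 = 0] makes the frequency [0]. *)
  by rewrite invr0 mul0r.
by rewrite mulrC ler_pdivrMr ?ltr0n// mul1r ler_nat.
Qed.

(** Apply [cvg_in_probability_mean] to the ratio and to [frequency (S p)], whose product is
    [frequency (T p)]. *)
Lemma frequency_ratio_mean (S T : forall p, Omega -> {set 'I_p}) (l s t : R) :
  (forall p, measurable_random_set (S p)) -> (forall p, measurable_random_set (T p)) ->
  (forall p w, T p w \subset S p w) ->
  cvg_in_probability P (fun p w => #|T p w|%:R / #|S p w|%:R) l ->
  Rintegral P setT (frequency (T p)) @[p --> \oo] --> t ->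
  Rintegral P setT (frequency (S p)) @[p --> \oo] --> s ->
  t = l * s.
Proof.
move=> mS mT TS TSl Tt Ss.
have ratio_itv p w : 0 <= (#|T p w|%:R / #|S p w|%:R : R) <= 1.
  rewrite divr_ge0//=; have := subset_leq_card (TS p w).
  case: #|S p w| => [|m] Tm; first by rewrite invr0 mulr0.
  by rewrite ler_pdivrMr ?ltr0n// mul1r ler_nat.
apply: (@cvg_in_probability_mean _ _ _ P
  (fun p w => #|T p w|%:R / #|S p w|%:R) (fun p => frequency (S p))) => //.
- move=> p; apply: measurable_funM; first exact: measurable_card.
  (* The inverse is the real power [-1], a measurable function; both conventions give [0] at [0]. *)
  rewrite (_ : (fun w => _) = fun w => (#|S p w|%:R : R) `^ (- 1)).
    exact: (measurableT_comp (measurable_powR (-1)) (measurable_card (mS p))).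
  by apply/funext => w; rewrite powR_inv1.
- by move=> p; exact: measurable_frequency.
- by move=> p w; exact: frequency_itv.
rewrite [X in X @ _ --> _](_ : _ = fun p => Rintegral P setT (frequency (T p)))//.
apply/funext => p; congr Rintegral; apply/funext => w; rewrite /frequency mulrCA.
(* If [S p w] is empty then so is [T p w], and both sides are [0]; otherwise the cardinality
   cancels. *)
have := subset_leq_card (TS p w); have [->|Sn0] := eqVneq #|S p w| 0%N.
  by rewrite leqn0 => /eqP ->; rewrite !(mul0r, mulr0).
by rewrite divfK// pnatr_eq0.
Qed.

(** If [l < 0], a nonnegative variable stays at distance at least [- l] from [l], so the event of
    exceeding [- l / 2] has probability one for every [k]. *)
Lemma cvg_in_probability_ge0 (U : nat -> Omega -> R) (l : R) :
  (forall k w, 0 <= U k w) -> cvg_in_probability P U l -> 0 <= l.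
Proof.
move=> U0 Ul; rewrite leNgt; apply/negP => l0.
have /fine_cvgP[_] : P [set w | - l / 2 < `|U k w - l|] @[k --> \oo] --> 0%E.
  by apply: Ul; rewrite divr_gt0// oppr_gt0.
rewrite (_ : fine \o _ = cst 1).
  move=> /(cvg_lim (@Rhausdorff R)); rewrite lim_cst//.
  by move=> /eqP; rewrite oner_eq0.
apply/funext => k /=; rewrite (_ : [set _ | _] = setT) ?probability_setT//.
apply/seteqP; split => // w _ /=.
have := U0 k w; rewrite -subr_ge0 => Uk.
by rewrite ger0_norm; lra.
Qed.

End RandomSets.

(** Linearity of expectation: the cardinality is a sum of [p] indicators, each of mean [c]. *)
Lemma mean_frequency d (Omega : measurableType d) (R : realType) (P : probability Omega R)
    (p : nat) (S : Omega -> {set 'I_p}) (c : R) : (0 < p)%N ->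
  measurable_random_set S -> (forall i, P [set w | i \in S w] = c%:E) ->
  Rintegral P setT (frequency R S) = c.
Proof.
move=> p0 mS PS; rewrite /frequency RintegralZl//; last first.
  apply: (@integrable_bounded _ _ _ P _ p%:R); first exact: measurable_card.
  by move=> w; rewrite ger0_norm// ler_nat -[leqRHS]card_ord max_card.
rewrite /Rintegral.
under eq_integral do rewrite natr_card_sum -sumEFin.
rewrite ge0_integral_sum//; last first.
  by move=> i; apply/measurable_EFinP; exact: measurable_random_mem.
rewrite (eq_bigr (fun=> c%:E)) => [|i _].
  rewrite sumEFin /= big_const_ord iter_addr_0 -(mulr_natl c) mulrA.
  by rewrite mulVf ?mul1r// pnatr_eq0 -lt0n.
rewrite -(PS i) -[in RHS](setIT [set w | i \in S w]) -integral_indic//.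
apply: eq_integral => w _; rewrite indicE; congr (nat_of_bool _)%:R%:E.
by apply/idP/idP => [iS|]; rewrite ?inE//; exact: mem_set.
Qed.

(** For an indicator [psi] the empirical mean is a frequency and its almost sure limit a
    probability; dominated convergence carries the limit over to expectations. *)
Lemma empirical_mean_frequency d (Omega : measurableType d) (R : realType)
    (P : probability Omega R) (Pi : probability (measurableTypeR R) R) (alpha tau : R)
    (bhat b : forall p : nat, 'I_p -> {RV P >-> R}) (g : R -> R -> bool)
    (psi : R -> R -> R) :
  (forall x y, psi x y = (g x y)%:R) ->
  (forall p, measurable_random_set
    (fun w => [set i : 'I_p | g (bhat p i w) (b p i w)]%SET)) ->
  measurable [set u : measurableTypeR R * measurableTypeR R |
    g (soft_threshold (alpha * tau) (u.1 + tau * u.2)) u.1] ->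
  empirical_mean_cvg Pi alpha tau bhat b psi ->
  Rintegral P setT
    (frequency R (fun w => [set i : 'I_p | g (bhat p i w) (b p i w)]%SET)) @[p --> \oo] -->
  fine (with_noise Pi [set u | g (soft_threshold (alpha * tau) (u.1 + tau * u.2)) u.1]).
Proof.
move=> psiE mS mG emp.
pose sel p w := [set i : 'I_p | g (bhat p i w) (b p i w)]%SET.
apply: bounded_ae_cvg_mean.
- by move=> p; exact: measurable_frequency.
- by move=> p w; have /andP[? ?] := frequency_itv R (sel p) w; rewrite ger0_norm.
move: emp; rewrite /empirical_mean_cvg.
rewrite (_ : 'E_(with_noise Pi)[_]%E = (fine (with_noise Pi
  [set u | g (soft_threshold (alpha * tau) (u.1 + tau * u.2)) u.1]))%:E).
  apply: filterS => w.
  rewrite (_ : (fun p => _) = (fun p => (frequency R (sel p) w)%:E))//.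
  apply/funext => p; rewrite /frequency natr_card_sum; congr (_ * _)%:E.
  by apply: eq_bigr => i _; rewrite psiE finset.inE.
rewrite fineK; last exact: fin_num_measure.
rewrite -(expectation_indic _ mG); congr expectation; apply/funext => u /=.
rewrite psiE indicE; congr (nat_of_bool _)%:R.
by apply/idP/idP => [gu|]; rewrite ?inE//; exact: mem_set.
Qed.

(** A point strictly between two members of a piece lies strictly between its endpoints, so each
    piece is order-convex and thus measurable. It misses [0] because it lies beyond [Delta] or below
    [- Delta]. *)
Lemma intervals_away_from_0_measurable (R : realType) (Delta : R) (A : set R) : 0 < Delta ->
  intervals_away_from_0 Delta A -> measurable A /\ ~ A 0.
Proof.
move=> D0 [M [I [a [b [-> _ Iab]]]]]; split.
  apply: fin_bigcup_measurable => // m _; have [_ [abI Iab'] _] := Iab m.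
  apply: is_interval_measurable => x y Ix Iy z /andP[xz zy].
  have [<-//|zx] := eqVneq x z; have [->//|zy'] := eqVneq z y.
  apply: abI => /=; have /andP[ax _] := Iab' _ Ix; have /andP[_ yb] := Iab' _ Iy.
  apply/andP; split; [apply: (le_lt_trans ax)|apply: (lt_le_trans _ yb)].
    by rewrite lte_fin lt_neqAle zx.
  by rewrite lte_fin lt_neqAle zy'.
case=> m _ I0; have [_ [_ Iab']] := Iab m; have /andP[a0 b0] := Iab' _ I0.
case=> [/lt_le_trans/(_ a0)|/(le_lt_trans b0)]; rewrite lte_fin.
  by rewrite ltNge ltW.
by rewrite oppr_gt0 ltNge ltW.
Qed.

(** The map [x |-> x / (x + c)] is nondecreasing. The value [f] enters through a product, which
    leaves it undetermined when [y + c = 0]; then the left side is [0] and [0 <= f] settles the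
    claim. *)
Lemma proportion_le (R : realFieldType) (x y c f : R) :
  0 <= x -> x <= y -> 0 <= c -> 0 <= f -> y = f * (y + c) -> x / (x + c) <= f.
Proof.
move=> x0 xy c0 f0 yE; have [xc|xc] := eqVneq (x + c) 0; first by rewrite xc invr0 mulr0.
have xc_gt0 : 0 < x + c by rewrite lt_neqAle eq_sym xc addr_ge0.
have yc_gt0 : 0 < y + c by rewrite (lt_le_trans xc_gt0)// lerD2r.
have -> : f = y / (y + c) by rewrite [X in X / _]yE mulfK ?gt_eqF.
by rewrite ler_pdivrMr// mulrAC ler_pdivlMr// !mulrDr mulrC lerD2l ler_wpM2r.
Qed.

(** * Comparison of a selection rule with the oracle *)

Theorem theorem4p3
  (R : realType) (d : measure_display) (Omega : measurableType d)
  (P : probability Omega R)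
  (delta sigma eps lambda : R)
  (delta_gt0 : 0 < delta) (sigma_gt0 : 0 < sigma) (eps01 : 0 < eps < 1)
  (lambda_gt0 : 0 < lambda)
  (n : nat -> nat)
  (n_ratio : (n p)%:R / p%:R @[p --> \oo] --> delta)
  (Pi Pi1 : probability (measurableTypeR R) R)
  (PiE : forall A : set R, measurable A ->
    Pi A = ((1 - eps)%:E * \d_(0%R : R) A + eps%:E * Pi1 A)%E)
  (Pi1_0 : Pi1 [set 0] = 0%E)
  (Pi_L2 : ('E_Pi[fun x : R => (x ^+ 2)%R] < +oo)%E)
  (X : forall p : nat, 'I_(n p) -> 'I_p -> {RV P >-> R})
  (beta : forall p : nat, 'I_p -> {RV P >-> R})
  (zeta : forall p : nat, 'I_(n p) -> {RV P >-> R})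
  (model : forall p : nat,
    gaussian_linear_model Pi sigma (X p) (beta p) (zeta p))
  (betahat : forall p : nat, 'I_p -> {RV P >-> R})
  (betahat_lasso : forall (p : nat) (w : Omega),
    let Xw : 'M[R]_(n p, p) := \matrix_(i, j) X p i j w in
    let Yw : 'cV[R]_(n p) :=
      Xw *m (\col_j beta p j w) + \col_i zeta p i w in
    is_lasso Xw Yw lambda (\col_j betahat p j w))
  (alpha_min alpha tau : R)
  (alpha_minP : is_alpha_min delta alpha_min)
  (tau_gt0 : 0 < tau) (alpha_gt : alpha_min < alpha)
  (alpha_tauP : state_evolution Pi delta sigma lambda alpha tau)
  (t0 Delta : R) (t0_gt0 : 0 < t0) (Delta_gt0 : 0 < Delta)
  (sublevel_intervals : forall s : R, 0 < s -> s <= t0 ->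
    intervals_away_from_0 Delta
      [set x : R | f0_over_f eps Pi Pi1 alpha tau x <= s])
  (tstar : R) (tstar_gt0 : 0 < tstar) (tstar_le : tstar <= t0)
  (phi : R -> R) (t : R)
  (phi_measurable : measurable [set x : R | t < phi x])
  (cvg_null : empirical_mean_cvg Pi alpha tau betahat beta
    (fun x y => (t < phi x)%R%:R * (y == 0)%:R))
  (cvg_all : empirical_mean_cvg Pi alpha tau betahat beta
    (fun x y => (t < phi x)%R%:R))
  (fdp_phi tpp_phi : R)
  (fdp_phiP : cvg_in_probability P
    (fun p w => FDP (fun i => beta p i w)
                    [set i : 'I_p | t < phi (betahat p i w)]%SET) fdp_phi)
  (tpp_phiP : cvg_in_probability P
    (fun p w => TPP (fun i => beta p i w)
                    [set i : 'I_p | t < phi (betahat p i w)]%SET) tpp_phi)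
  (tpp_phi_eq : tpp_phi = tpp_star eps Pi1 alpha tau tstar) :
  fdp_star eps Pi1 alpha tau tstar <= fdp_phi.
Proof.
case/andP: (eps01) => eps0 eps1.
have alpha_ge0 : 0 <= alpha.
  apply: le_trans (ltW alpha_gt); move: alpha_minP; rewrite /is_alpha_min.
  by case: ifP => [_ ->|_ []].
set S := soft_threshold (alpha * tau).
set T := fun u : measurableTypeR R * measurableTypeR R => S (u.1 + tau * u.2).
pose A := [set x : R | t < phi x].
pose B := [set x | oracle_accepts eps Pi1 alpha tau tstar x].
have [mSub Sub0] := intervals_away_from_0_measurable Delta_gt0
  (sublevel_intervals _ tstar_gt0 tstar_le).
(* The sublevel set at [tstar] misses [0], so the ratio of the atoms exceeds [tstar]. *)
have f0_gt : tstar < f0_over_f eps Pi Pi1 alpha tau 0.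
  by rewrite ltNge; apply/negP.
(* For the same reason the exclusion of [0] in [oracle_accepts] removes nothing: [B] is the whole
   sublevel set, a finite union of intervals. *)
have mB : measurable B.
  rewrite (_ : B = [set x | f0_over_f eps Pi Pi1 alpha tau x <= tstar])//.
  apply/seteqP; split => x; rewrite /B /= /oracle_accepts /f0_over_f; case: eqVneq => // ->.
  by move=> x0; case: Sub0; rewrite /= /f0_over_f eqxx.
have mT : measurable_fun setT T by exact: measurable_noisy_estimate.
have mTA (C : set R) : measurable C -> measurable (T @^-1` C).
  by move=> mC; rewrite -[X in measurable X]setTI; exact: mT.
have m0 : measurable [set u : measurableTypeR R * measurableTypeR R | u.1 == 0].
  rewrite (_ : [set _ | _] = [set 0] `*` setT); first exact: measurableX.
  by apply/seteqP; split => -[x y] /=; [move/eqP|case=> /eqP].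
have mA0 : measurable [set u : measurableTypeR R * measurableTypeR R |
    (t < phi (T u)) && (u.1 == 0)].
  rewrite (_ : [set _ | _] = T @^-1` A `&` [set u | u.1 == 0]).
    by apply: measurableI => //; exact: mTA.
  by apply/seteqP; split => u /= /andP.
have mS0 (C : set R) : measurable C ->
    measurable [set z : measurableTypeR R | C (S (tau * z))].
  move=> mC; rewrite -[X in measurable X]setTI.
  exact: (measurable_null_estimate tau_gt0 alpha_ge0).
(* [n0] and [n1] are the null and signal masses of the selection region [A]. *)
have [n0 [n0_ge0 n0E]] : exists r, 0 <= r /\
    normal_prob (0 : R) 1 [set z | A (S (tau * z))] = r%:E.
  exists (fine (normal_prob (0 : R) 1 [set z | A (S (tau * z))])); split.
    by apply: fine_ge0; exact: measure_ge0.
  by rewrite fineK// fin_num_measure//; exact: mS0.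
have [n1 [n1_ge0 n1E]] : exists r, 0 <= r /\ with_noise Pi1 (T @^-1` A) = r%:E.
  exists (fine (with_noise Pi1 (T @^-1` A))); split.
    by apply: fine_ge0; exact: measure_ge0.
  by rewrite fineK// fin_num_measure//; exact: mTA.
have null_le : n1 = tpp_star eps Pi1 alpha tau tstar ->
    null_star eps Pi1 alpha tau tstar <= n0.
  move=> n1_star; rewrite -[leRHS]/(fine n0%:E) -n0E; apply: fine_le.
  - exact: fin_num_measure (mS0 _ mB).
  - exact: fin_num_measure (mS0 _ phi_measurable).
  - apply: (oracle_null_minimal eps01 PiE tau_gt0 alpha_ge0 (ltW tstar_gt0) f0_gt
      mB phi_measurable).
    apply: (etrans n1E); rewrite n1_star; apply: fineK.
    exact: fin_num_measure (mTA _ mB).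
clear f0_gt mSub Sub0.
have all_mass : fine (with_noise Pi [set u | t < phi (T u)]) = (1 - eps) * n0 + eps * n1.
  rewrite (noisy_estimate_mixture eps01 PiE tau_gt0 alpha_ge0 phi_measurable).
  by rewrite -/T n1E [X in (_ * X)%E]n0E.
have null_mass : fine (with_noise Pi [set u | (t < phi (T u)) && (u.1 == 0)]) = (1 - eps) * n0.
  rewrite (with_noise_mixture eps01 PiE mA0).
  (* The signal law does not charge [0], so on [u.1 == 0] only the Dirac component remains. *)
  rewrite [X in (_ + _ * X)%E](_ : _ = 0%E); last first.
    apply: (subset_measure0 (mu := with_noise Pi1) mA0 m0).

      by move=> u /= /andP[].
    rewrite (_ : [set _ | _] = [set 0] `*` setT).
      transitivity (Pi1 [set 0%R] * normal_prob (0 : R) 1 setT)%E; last by rewrite Pi1_0 mul0e.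
      exact: product_measure1E.
    by apply/seteqP; split => -[x y] /=; [move/eqP|case=> /eqP].
  rewrite mule0 adde0 [X in (_ * X)%E](_ : _ = n0%:E)//.
  rewrite -n0E; congr normal_prob; apply/seteqP; split => z /=.
    by rewrite /T /= add0r => /andP[].
  by rewrite /T /= add0r eqxx andbT.
pose Sel p w := [set i : 'I_p | t < phi (betahat p i w)]%SET.
pose Nul p w := [set i : 'I_p | beta p i w == 0]%SET.
pose Nnul p w := [set i : 'I_p | beta p i w != 0]%SET.
have mbeta p (i : 'I_p) (C : set R) : measurable C -> measurable [set w | C (beta p i w)].
  by move=> mC; rewrite -[X in measurable X]setTI; exact: measurable_funP.
have mSel p : measurable_random_set (Sel p).
  move=> i; rewrite (_ : [set _ | _] = [set w | A (betahat p i w)]).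
    by rewrite -[X in measurable X]setTI; exact: measurable_funP.
  by apply/seteqP; split => w /=; rewrite finset.inE.
have mNul p : measurable_random_set (Nul p).
  move=> i; rewrite (_ : [set _ | _] = [set w | [set 0] (beta p i w)]); first exact: mbeta.
  by apply/seteqP; split => w /=; rewrite finset.inE => /eqP.
have NnulE p (i : 'I_p) : [set w | i \in Nnul p w] = [set w | (~` [set 0]) (beta p i w)].
  by apply/seteqP; split => w /=; rewrite finset.inE => /eqP.
have mNnul p : measurable_random_set (Nnul p).
  by move=> i; rewrite NnulE; apply: mbeta; exact: measurableC.
have SelNulE p w : [set i : 'I_p | (t < phi (betahat p i w)) && (beta p i w == 0)]%SET =
    (Sel p w :&: Nul p w)%SET.
  by apply/setP => i; rewrite !finset.inE.
have mSelNul p := measurable_random_setI (mSel p) (mNul p).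
have mSelNnul p := measurable_random_setI (mSel p) (mNnul p).
have sel_mean : Rintegral P setT (frequency R (Sel p)) @[p --> \oo] -->
    (1 - eps) * n0 + eps * n1.
  rewrite -all_mass.
  apply: (empirical_mean_frequency (g := fun x _ => t < phi x) _ _ _ cvg_all).
  - by [].
  - exact: mSel.
  - exact: (mTA _ phi_measurable).
have null_mean : Rintegral P setT (frequency R (fun w => Sel p w :&: Nul p w)%SET)
    @[p --> \oo] --> (1 - eps) * n0.
  rewrite -null_mass.
  rewrite (_ : (fun p => _) = fun p => Rintegral P setT (frequency R (fun w =>
    [set i : 'I_p | (t < phi (betahat p i w)) && (beta p i w == 0)]%SET))).
    apply: (empirical_mean_frequency (g := fun x y => (t < phi x) && (y == 0)) _ _ _ cvg_null).
    - by move=> x y; rewrite -natrM mulnb.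
    - move=> p; rewrite (_ : (fun w => _) = fun w => (Sel p w :&: Nul p w)%SET)//.
      by apply/funext => w; exact: SelNulE.
    - exact: mA0.
  apply/funext => p; congr Rintegral; congr frequency.
  by apply/funext => w; rewrite SelNulE.
have nonnull_mean : Rintegral P setT (frequency R (fun w => Sel p w :&: Nnul p w)%SET)
    @[p --> \oo] --> eps * n1.
  (* Only the limits for all selections and for null selections are assumed; the non-null selections
     are their difference. *)
  rewrite (_ : eps * n1 = (1 - eps) * n0 + eps * n1 - (1 - eps) * n0); last by ring.
  rewrite (_ : (fun p => _) = fun p => Rintegral P setT (frequency R (Sel p)) -
    Rintegral P setT (frequency R (fun w => Sel p w :&: Nul p w)%SET)).
    exact: cvgB.
  apply/funext => p; rewrite -RintegralB//; last 2 first.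
  - apply: (@integrable_bounded _ _ _ _ _ 1); first exact: measurable_frequency.
    by move=> w; have /andP[? ?] := frequency_itv R (Sel p) w; rewrite ger0_norm.
  - apply: (@integrable_bounded _ _ _ _ _ 1); first exact: measurable_frequency.
    by move=> w; have /andP[? ?] := frequency_itv R (fun w => Sel p w :&: Nul p w)%SET w;
      rewrite ger0_norm.
  congr Rintegral; apply/funext => w; rewrite /frequency -mulrBr; congr (_ * _).
  rewrite -(cardsID (Nul p w) (Sel p w)) natrD addrC addKr; congr (_%:R).
  by apply: eq_card => i; rewrite !finset.inE andbC.
have sparsity_mean : Rintegral P setT (frequency R (Nnul p)) @[p --> \oo] --> eps.
  (* For every [p > 0] the mean is exactly [eps]: each coefficient is nonzero with probability
     [eps], as [Pi1] has no mass at [0]. *)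
  apply: cvg_near_cst; near=> p.
  apply: mean_frequency => // [|i]; first by near: p; exact: nbhs_infty_gt.
  have [_ _ /(_ i) law _] := model p.
  have mC0 : measurable (~` [set 0 : R]) by exact: measurableC.
  rewrite NnulE; transitivity (Pi (~` [set 0])); first exact: (law _ mC0).
  rewrite PiE// diracE memNset/= ?mule0 ?add0e; last by move=> /(_ erefl).
  by rewrite probability_setC// Pi1_0 sube0 mule1.
(* The product form stays valid when the selected mass is zero, where the quotient would carry no
   information. *)
have fdp_eq : (1 - eps) * n0 = fdp_phi * ((1 - eps) * n0 + eps * n1).
  apply: (frequency_ratio_mean mSel mSelNul _ fdp_phiP null_mean sel_mean) => p w.
  exact: subsetIl.
have tpp_eq : eps * n1 = tpp_phi * eps.
  apply: (frequency_ratio_mean mNnul mSelNnul _ tpp_phiP nonnull_mean sparsity_mean) => p w.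
  exact: subsetIr.
have fdp_ge0 : 0 <= fdp_phi.
  by apply: (cvg_in_probability_ge0 _ fdp_phiP) => p w; rewrite divr_ge0.
(* Since [eps] is positive it cancels, and the assumed equality of TPP limits becomes equality of
   signal masses. *)
have n1E' : n1 = tpp_phi.
  by apply: (mulfI (lt0r_neq0 eps0)); rewrite tpp_eq mulrC.
(* Both proportions share the true-positive term [c = eps * n1] and differ only in their null
   masses, ordered by [null_le]. *)
rewrite /fdp_star -tpp_phi_eq -n1E'; apply: (proportion_le _ _ _ fdp_ge0 fdp_eq).
- apply: mulr_ge0; first by rewrite subr_ge0 ltW.
  by apply: fine_ge0; exact: measure_ge0.
- apply: ler_wpM2l; first by rewrite subr_ge0 ltW.
  by apply: null_le; rewrite n1E'.
- exact: mulr_ge0 (ltW eps0) n1_ge0.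
Unshelve. all: by end_near. Qed.
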